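(* Let $F$ be a DeMorgan circuit computing a Boolean function $f:\{0,1\}^n\to\{0,1\}$. Then the monotone version $F^+$ computes $f^{\uparrow}$ if and only if for every zero-term $t$ produced by $F$, its positive factor $t^+$ satisfies $t^+\le f^{\uparrow}$ (i.e., is an implicant of $f^{\uparrow}$).
   Context: A DeMorgan circuit on $x_1,\dots,x_n$ has fan-in-2 AND/OR gates and inputs $0,1,x_i,\bar x_i$. A term is an AND of literals; a zero-term contains some $x_i$ together with $\bar x_i$. Produced terms: at an input gate, the literal/constant itself; at an OR gate, the union of the sets of terms produced at its two inputs; at an AND gate, all $t_1\land t_2$ with $t_1,t_2$ produced at the two inputs (the law $x\bar x=0$ is not applied, so zero-terms may be produced). The upwards closure is $f^{\uparrow}(x)=\bigvee_{z\le x}f(z)$. The monotone version $F^+$ is obtained by replacing every negated input $\bar x_i$ by the constant $1$. The positive factor $t^+$ of a term $t$ is obtained by replacing each negated literal in $t$ by the constant $1$. *)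

(* Defs.v *)
From HB Require Import structures.
From mathcomp Require Import all_boot.

Set Implicit Arguments.
Unset Strict Implicit.
Unset Printing Implicit Defensive.

Definition point (n : nat) := {ffun 'I_n -> bool}.

Definition boolfun (n : nat) := point n -> bool.

Definition ple (n : nat) (z x : point n) : bool := [forall i, z i ==> x i].

Definition fle (n : nat) (g h : boolfun n) : Prop := forall x, g x -> h x.

Definition up_closure (n : nat) (f : boolfun n) : boolfun n :=
  fun x => [exists z, ple z x && f z].

Inductive atom (n : nat) : Type :=
  | Const of bool
  | Pos of 'I_n
  | Neg of 'I_n.
Arguments Const {n} _.

Definition atom_code (n : nat) (a : atom n) : bool + ('I_n + 'I_n) :=
  match a with
  | Const b => inl b
  | Pos i => inr (inl i)
  | Neg i => inr (inr i)
  end.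

Definition atom_decode (n : nat) (c : bool + ('I_n + 'I_n)) : atom n :=
  match c with
  | inl b => Const b
  | inr (inl i) => Pos i
  | inr (inr i) => Neg i
  end.

Lemma atom_codeK (n : nat) : cancel (@atom_code n) (@atom_decode n).
Proof. by case. Qed.

HB.instance Definition _ (n : nat) :=
  Finite.copy (atom n) (can_type (@atom_codeK n)).

Definition atom_eval (n : nat) (x : point n) (a : atom n) : bool :=
  match a with
  | Const b => b
  | Pos i => x i
  | Neg i => ~~ x i
  end.

Definition atom_plus (n : nat) (a : atom n) : atom n :=
  if a is Neg _ then Const true else a.

(* A term is the conjunction of its members.  Constants are kept as formal    *)
(* factors, since input gates may be constants and the positive factor of a   *)
(* term contains the constant 1; a factor 0 makes the term evaluate to 0 but  *)
(* does not by itself make it a zero-term.                                    *)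
Definition term (n : nat) := {set atom n}.

Definition term_eval (n : nat) (t : term n) : boolfun n :=
  fun x => [forall a in t, atom_eval x a].

Definition zero_term (n : nat) (t : term n) : bool :=
  [exists i, (Pos i \in t) && (Neg i \in t)].

Definition positive_factor (n : nat) (t : term n) : term n :=
  [set atom_plus a | a in t].

(* A gate that may read any of k earlier gates.                               *)
Inductive gate (n k : nat) : Type :=
  | Input of atom n
  | AndGate of 'I_k & 'I_k
  | OrGate of 'I_k & 'I_k.
Arguments Input {n k} _.
Arguments AndGate {n k} _ _.
Arguments OrGate {n k} _ _.

(* Gates are listed in a topological order, so the underlying graph is an     *)
(* arbitrary finite acyclic one, with unbounded fan-out.                      *)
Inductive gates (n : nat) : nat -> Type :=
  | NoGate : gates n 0
  | AddGate k : gates n k -> gate n k -> gates n k.+1.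

Record circuit (n : nat) := Circuit {
  circuit_size : nat;
  circuit_gates : gates n circuit_size;
  circuit_output : 'I_circuit_size
}.

Section Semantics.
Variables (n : nat) (A : Type) (inp : atom n -> A) (conj disj : A -> A -> A).

Definition gate_sem (k : nat) (v : 'I_k -> A) (g : gate n k) : A :=
  match g with
  | Input a => inp a
  | AndGate i j => conj (v i) (v j)
  | OrGate i j => disj (v i) (v j)
  end.

(* In a list of k.+1 gates, the last added one has index ord_max.             *)
Fixpoint gates_sem (k : nat) (G : gates n k) : 'I_k -> A :=
  match G in gates _ k return 'I_k -> A with
  | NoGate => fun i => False_rect A (notF (ltn_ord i))
  | AddGate _ G' g => fun i =>
      if unlift ord_max i is Some j then gates_sem G' j
      else gate_sem (gates_sem G') g
  end.

Definition circuit_sem (F : circuit n) : A :=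
  gates_sem (circuit_gates F) (circuit_output F).

End Semantics.

Definition circuit_eval (n : nat) (F : circuit n) : boolfun n :=
  fun x => circuit_sem (atom_eval x) andb orb F.

Definition computes (n : nat) (F : circuit n) (f : boolfun n) : Prop :=
  circuit_eval F =1 f.

Definition produced (n : nat) (F : circuit n) : {set term n} :=
  circuit_sem (fun a => [set [set a]])
    (fun T1 T2 => [set t1 :|: t2 | t1 in T1, t2 in T2])
    (fun T1 T2 => T1 :|: T2) F.

Definition gate_plus (n k : nat) (g : gate n k) : gate n k :=
  match g with
  | Input a => Input (atom_plus a)
  | AndGate i j => AndGate i j
  | OrGate i j => OrGate i j
  end.

Fixpoint gates_plus (n k : nat) (G : gates n k) : gates n k :=
  match G in gates _ k return gates n k with
  | NoGate => NoGate n
  | AddGate _ G' g => AddGate (gates_plus G') (gate_plus g)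
  end.

Definition monotone_version (n : nat) (F : circuit n) : circuit n :=
  Circuit (gates_plus (circuit_gates F)) (circuit_output F).

(* Main.v *)
Require Import Defs.
From mathcomp Require Import all_boot.

(** A circuit computes the disjunction of its produced terms under every
    assignment of truth values to the atoms, including those treating [x_i] and
    its negation as independent; so [F^+] computes the disjunction of the
    positive factors.  A term true at [z] has a positive factor true at every
    point above [z], whence [f^up <= F^+].  Conversely, a point [x] accepted by the
    positive factor of a term [t] that is not a zero-term lies above a point
    accepted by [t]: set to 0 the variables negated in [t]. *)

(** A union of two terms holds under [s] exactly when both terms do, so an AND gate amounts to
    distributivity. Nothing relates [s (Pos i)] to [s (Neg i)], since production never cancels
    zero-terms. *)
Lemma gates_sem_terms (n : nat) (s : atom n -> bool) (k : nat) (G : gates n k)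
    (i : 'I_k) :
  gates_sem s andb orb G i =
  [exists t in gates_sem (fun a => [set [set a]])
     (fun T1 T2 : {set term n} => [set t1 :|: t2 | t1 in T1, t2 in T2])
     (fun T1 T2 => T1 :|: T2) G i, [forall a in t, s a]].
Proof.
elim: G i => [|k' G IH g] i /=; first by case: (notF (ltn_ord i)).
case: (unlift ord_max i) => [j|]; first exact: IH.
case: g => [a|i1 i2|i1 i2] /=.
- apply/idP/exists_inP => [sa|[t /set1P ->]].
    by exists [set a]; rewrite ?set11 //; apply/forall_inP => b /set1P ->.
  by move/forall_inP; apply; rewrite set11.
- rewrite !IH; apply/andP/exists_inP.
  + case=> /exists_inP[t1 t1P /forall_inP s1] /exists_inP[t2 t2P /forall_inP s2].
    exists (t1 :|: t2); first exact: imset2_f.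
    by apply/forall_inP => a /setUP[/s1|/s2].
  + case=> _ /imset2P[t1 t2 t1P t2P ->] /forall_inP s12.
    split; apply/exists_inP; [exists t1|exists t2] => //;
      by apply/forall_inP => a at_; apply: s12; rewrite inE at_ ?orbT.
- rewrite !IH; apply/orP/exists_inP.
  + by case=> /exists_inP[t tP st]; exists t; rewrite // inE tP ?orbT.
  + by case=> t /setUP[] tP st; [left|right]; apply/exists_inP; exists t.
Qed.

Lemma circuit_eval_terms (n : nat) (F : circuit n) (x : point n) :
  circuit_eval F x = [exists t in produced F, term_eval t x].
Proof. exact: gates_sem_terms. Qed.

(** Moves [atom_plus] from the circuit into the valuation, so that [F^+] is expanded over the terms
    of [F] itself. *)
Lemma gates_sem_plus (n : nat) (A : Type) (inp : atom n -> A)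
    (conj disj : A -> A -> A) (k : nat) (G : gates n k) (i : 'I_k) :
  gates_sem inp conj disj (gates_plus G) i =
  gates_sem (fun a => inp (atom_plus a)) conj disj G i.
Proof.
elim: G i => [|k' G IH g] i //=.
case: (unlift ord_max i) => [j|]; first exact: IH.
by case: g => [a|i1 i2|i1 i2] /=; rewrite ?IH.
Qed.

Lemma term_eval_positive_factor (n : nat) (t : term n) (x : point n) :
  term_eval (positive_factor t) x = [forall a in t, atom_eval x (atom_plus a)].
Proof.
apply/forall_inP/forall_inP => [tx a ta|tx _ /imsetP[a ta ->]]; last exact: tx.
by apply: tx; apply: imset_f.
Qed.

Lemma monotone_version_terms (n : nat) (F : circuit n) (x : point n) :
  circuit_eval (monotone_version F) x =
  [exists t in produced F, term_eval (positive_factor t) x].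
Proof.
rewrite /circuit_eval /circuit_sem gates_sem_plus gates_sem_terms.
by apply: eq_existsb => t; rewrite term_eval_positive_factor.
Qed.

Lemma positive_factor_above (n : nat) (t : term n) (z x : point n) :
  ple z x -> term_eval t z -> term_eval (positive_factor t) x.
Proof.
move=> /forallP zx /forall_inP tz; rewrite term_eval_positive_factor.
apply/forall_inP => -[b|i|i] //= /tz //=.
by move: (zx i) => /implyP.
Qed.

Lemma positive_factor_below (n : nat) (t : term n) (x : point n) :
  ~~ zero_term t -> term_eval (positive_factor t) x ->
  exists2 z, ple z x & term_eval t z.
Proof.
rewrite term_eval_positive_factor => /existsPn nz /forall_inP tx.
exists [ffun i => x i && (Neg i \notin t)].
  by apply/forallP => i; rewrite ffunE; apply/implyP => /andP[].
apply/forall_inP => -[b|i|i] ta /=; first exact: (tx _ ta).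
  (* With [Pos i] in [t], the term not being a zero-term excludes [Neg i], so the witness keeps the
     value [x i], which is 1. *)
  by rewrite ffunE; have /= -> := tx _ ta; move: (nz i); rewrite ta.
by rewrite ffunE ta andbF.
Qed.

Theorem theorem2 (n : nat) (F : circuit n) (f : boolfun n)
    (F_computes_f : computes F f) :
  computes (monotone_version F) (up_closure f) <->
  (forall t : term n, t \in produced F -> zero_term t ->
     fle (term_eval (positive_factor t)) (up_closure f)).
Proof.
split=> [Fup t tF _ x tx|zero_le x].
  by rewrite -Fup monotone_version_terms; apply/exists_inP; exists t.
rewrite monotone_version_terms; apply/exists_inP/existsP.
  (* Zero-terms are covered by the hypothesis; any other term is true at some [z] below [x], where
     [f] is then 1. *)
  case=> t tF tx; have [t0|nz] := boolP (zero_term t).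
    by have /existsP := zero_le t tF t0 x tx.
  have [z zx tz] := positive_factor_below _ _ _ nz tx.
  exists z; rewrite zx -F_computes_f circuit_eval_terms.
  by apply/exists_inP; exists t.
case=> z /andP[zx]; rewrite -F_computes_f circuit_eval_terms.
case/exists_inP=> t tF tz; exists t => //.
exact: positive_factor_above zx tz.
Qed.
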